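(* Let $n\ge2$ and let $X_1,\dots,X_n$ be random variables with $EX_k=0$, $k=1,\dots,n$, with one-dimensional cdf's $F_1,\dots,F_n$, whose joint cdf is absolutely continuous with respect to $\prod_{k=1}^nF_k(x_k)$. Let $\xi_1,\dots,\xi_n$ be independent random variables with cdf's $F_1,\dots,F_n$, and let $g_{i_1,\dots,i_c}$ be the canonical functions of the joint distribution of $X_1,\dots,X_n$. Then $X_1,\dots,X_n$ are orthogonal if and only if $$E\,\xi_i\xi_j\,g_{ij}(\xi_i,\xi_j)=0\quad\text{for all }1\le i<j\le n.$$
   Context: Random variables $X_1,\dots,X_n$ with $EX_i=0$ are called orthogonal if $EX_iX_j=0$ for all $1\le i<j\le n$. (A condition that an expectation equals a number includes that the expectation exists.) Canonical functions: if the joint cdf $F$ of $X_1,\dots,X_n$ is absolutely continuous with respect to the product of its marginals, i.e. $F(x_1,\dots,x_n)=\int_{-\infty}^{x_1}\cdots\int_{-\infty}^{x_n}G\,dF_1\cdots dF_n$ for some Borel $G\ge0$, then there exist Borel functions $g_{i_1,\dots,i_c}:\mathbf R^c\to\mathbf R$, $1\le i_1<\dots<i_c\le n$, $c=2,\dots,n$, with: (A1) $E|g_{i_1,\dots,i_c}(\xi_{i_1},\dots,\xi_{i_c})|<\infty$; (A2) $E(g_{i_1,\dots,i_c}(\xi_{i_1},\dots,\xi_{i_c})\mid\xi_{i_1},\dots,\xi_{i_{k-1}},\xi_{i_{k+1}},\dots,\xi_{i_c})=0$ (a.s.) for $k=1,\dots,c$; (A3) $U_n(\xi_1,\dots,\xi_n):=\sum_{c=2}^n\sum_{1\le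 i_1<\dots<i_c\le n}g_{i_1,\dots,i_c}(\xi_{i_1},\dots,\xi_{i_c})\ge-1$ (a.s.); and $$F(x_1,\dots,x_n)=\int_{-\infty}^{x_1}\cdots\int_{-\infty}^{x_n}(1+U_n(t_1,\dots,t_n))\prod_{i=1}^ndF_i(t_i).$$ The random variables $g_{i_1,\dots,i_c}(\xi_{i_1},\dots,\xi_{i_c})$ are a.s. uniquely determined by $F$. These $g_{i_1,\dots,i_c}$ are called here the canonical functions of the joint distribution. *)

(* Defs.v *)
From HB Require Import structures.
From mathcomp Require Import all_boot all_order all_algebra.
From mathcomp Require Import all_classical all_reals all_analysis.

Set Implicit Arguments.
Unset Strict Implicit.
Unset Printing Implicit Defensive.

Import Order.TTheory GRing.Theory Num.Theory.
Import numFieldNormedType.Exports.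

Local Open Scope classical_set_scope.
Local Open Scope ring_scope.

(* "E Y = a" includes that the expectation exists: since a is finite, this
   means that Y is integrable. *)
Definition expectation_is d (T : measurableType d) (R : realType)
    (P : probability T R) (Y : T -> R) (a : R) : Prop :=
  P.-integrable setT (EFin \o Y) /\ ('E_P[Y] = a%:E)%E.

Definition orthogonal_rvs d (T : measurableType d) (R : realType)
    (P : probability T R) n (X : 'I_n -> {RV P >-> R}) : Prop :=
  forall i j : 'I_n, (i < j)%N ->
    expectation_is P (fun w => X i w * X j w) 0.

Definition mutually_independent d (T : measurableType d) (R : realType)
    (P : probability T R) n (X : 'I_n -> {RV P >-> R}) : Prop :=
  forall (J : {set 'I_n}) (B : 'I_n -> set R),
    (forall i, measurable (B i)) ->
    P (\bigcap_(i in [set` J]) X i @^-1` B i) =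
      (\prod_(i in J) P (X i @^-1` B i))%E.

(* Z is a version of the conditional expectation of Y given the
   sub-sigma-algebra G. *)
Definition is_cond_expectation d (T : measurableType d) (R : realType)
    (P : probability T R) (G : set (set T)) (Y Z : T -> R) : Prop :=
  [/\ P.-integrable setT (EFin \o Z),
      forall B : set R, measurable B -> G (Z @^-1` B) &
      forall A, G A ->
        (\int[P]_(w in A) (Z w)%:E = \int[P]_(w in A) (Y w)%:E)%E].

Definition sigma_rv d (T : measurableType d) (R : realType)
    (P : probability T R) n (X : 'I_n -> {RV P >-> R}) (I : set 'I_n) :
    set (set T) :=
  <<s \bigcup_(i in I) preimage_set_system setT (X i) measurable >>.

Section product_probability.
Context (R : realType) (n : nat).

Definition pair_cons (x : R * n.-tuple R) : n.+1.-tuple R :=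
  [the n.+1.-tuple R of x.1 :: x.2].

Lemma measurable_pair_cons : measurable_fun [set: R * n.-tuple R] pair_cons.
Proof. exact: measurable_cons. Qed.

HB.instance Definition _ :=
  isMeasurableFun.Build _ _ _ _ pair_cons measurable_pair_cons.

End product_probability.

Fixpoint product_probability (R : realType) n :
    ('I_n -> probability R R) -> probability (n.-tuple R) R :=
  match n with
  | 0 => fun=> \d_ [tuple]
  | m.+1 => fun mu =>
      distribution
        (mu ord0 \x @product_probability R m (fun i : 'I_m => mu (lift ord0 i)))%E
        (@pair_cons R m)
  end.

Definition rv_tuple d (T : measurableType d) (R : realType)
    (P : probability T R) n (X : 'I_n -> {RV P >-> R}) (w : T) : n.-tuple R :=
  [tuple X i w | i < n].

Definition lower_orthant (R : realType) n (x : n.-tuple R) : set (n.-tuple R) :=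
  [set t | forall i, tnth t i <= tnth x i].

Definition joint_cdf d (T : measurableType d) (R : realType)
    (P : probability T R) n (X : 'I_n -> {RV P >-> R}) (x : n.-tuple R) :
    \bar R :=
  P (rv_tuple X @^-1` lower_orthant x).

(* The measure dF_1 ... dF_n: the Stieltjes measure of the marginal cdf F_i is
   the distribution of X_i. *)
Definition product_of_marginals d (T : measurableType d) (R : realType)
    (P : probability T R) n (X : 'I_n -> {RV P >-> R}) :
    probability (n.-tuple R) R :=
  product_probability (fun i => distribution P (X i)).

Definition has_density_wrt_marginals d (T : measurableType d) (R : realType)
    (P : probability T R) n (X : 'I_n -> {RV P >-> R}) (h : n.-tuple R -> R) :
    Prop :=
  forall x : n.-tuple R,
    (joint_cdf X x =
      \int[product_of_marginals X]_(t in lower_orthant x) (h t)%:E)%E.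

Definition joint_cdf_abs_continuous d (T : measurableType d) (R : realType)
    (P : probability T R) n (X : 'I_n -> {RV P >-> R}) : Prop :=
  exists G : n.-tuple R -> R,
    [/\ measurable_fun setT G, forall t, 0 <= G t &
        has_density_wrt_marginals X G].

Definition increasing_idx n c (s : c.-tuple 'I_n) : bool :=
  sorted (fun i j : 'I_n => (i < j)%N) s.

Definition subtuple (R : Type) n c (s : c.-tuple 'I_n) (t : n.-tuple R) :
    c.-tuple R :=
  [tuple tnth t (tnth s k) | k < c].

(* [g c s] stands for g_{i_1,...,i_c} with s = (i_1,...,i_c); it is relevant
   only when 2 <= c and s is increasing. *)
Definition indexed_functions (R : realType) n : Type :=
  forall c : nat, c.-tuple 'I_n -> c.-tuple R -> R.

Definition canonical_sum (R : realType) n (g : indexed_functions R n)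
    (t : n.-tuple R) : R :=
  \sum_(2 <= c < n.+1) \sum_(s : c.-tuple 'I_n | increasing_idx s)
    g c s (subtuple s t).

(* Meant for xi a family of independent random variables, possibly on another
   probability space, with the same marginal cdf's as X. Only the joint cdf of
   X enters, in the last clause. *)
Record canonical_functions d d' (T : measurableType d) (T' : measurableType d')
    (R : realType) (P : probability T R) (P' : probability T' R) n
    (X : 'I_n -> {RV P >-> R}) (xi : 'I_n -> {RV P' >-> R})
    (g : indexed_functions R n) : Prop := CanonicalFunctions {
  canonical_borel : forall c (s : c.-tuple 'I_n), (2 <= c)%N -> increasing_idx s ->
    measurable_fun setT (g c s);
  canonical_A1 : forall c (s : c.-tuple 'I_n), (2 <= c)%N -> increasing_idx s ->
    P'.-integrable setT (fun w => (g c s (subtuple s (rv_tuple xi w)))%:E);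
  canonical_A2 : forall c (s : c.-tuple 'I_n), (2 <= c)%N -> increasing_idx s ->
    forall k : 'I_c,
      is_cond_expectation P'
        (sigma_rv xi [set tnth s l | l in [set l | l != k]])
        (fun w => g c s (subtuple s (rv_tuple xi w))) (cst 0);
  canonical_A3 : {ae P', forall w, -1 <= canonical_sum g (rv_tuple xi w)};
  canonical_density :
    has_density_wrt_marginals X (fun t => 1 + canonical_sum g t)
}.

(* Main.v *)
(* By (A2) and independence, every canonical function other than g_ij has integral
   zero over the events {xi_i in A, xi_j in B}: its index contains some k outside
   {i, j}. Hence the law of (X_i, X_j) has density 1 + g_ij with respect to the law
   of (xi_i, xi_j), which gives
     E X_i X_j = E xi_i xi_j (1 + g_ij(xi_i, xi_j)) = E xi_i xi_j g_ij(xi_i, xi_j),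
   where xi_i xi_j is integrable with mean 0 by independence. The density
   1 + g_ij is a.e. nonnegative because its integrals over the events
   {(xi_i, xi_j) in C} are probabilities, so the identity transfers integrability
   in both directions. *)
From HB Require Import structures.
Require Import Defs.
From mathcomp Require Import all_boot all_order all_algebra.
From mathcomp Require Import all_classical all_reals all_analysis.
From mathcomp Require Import measurable_realfun lra.

Set Implicit Arguments.
Unset Strict Implicit.
Unset Printing Implicit Defensive.

Import Order.TTheory GRing.Theory Num.Theory.
Import numFieldNormedType.Exports.
Import HBNNSimple.

Local Open Scope classical_set_scope.
Local Open Scope ring_scope.

(** One principle carries every passage from sets to integrals: if two nonnegative weights [f1],
    [f2] have equal integrals over [phi1 @^-1] A[and]phi2 @^-1[A] for all measurable [A], then the
    weighted integrals of [u \o phi1] and [u \o phi2] agree. The weights are 1 and the truncation of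
    1 + g_ij at 0 when passing from X to xi; the indicator of an event and its probability when
    using independence; v(Z) and its mean when computing the expectation of a product. The set
    identities come from generating families stable under intersection. The functions 1 + U_n and 1
    + g_ij may be negative at some points, so the pi-lambda argument is run on integrable functions
    instead of measures. Lower orthants do not include the whole space, so equality of the total
    integrals has to be established separately; this is why the integral of U_n itself is
    computed. *)

(** * Integrals determined by a generating family, and transfer between weights *)

Lemma measurable_preimage d d' (T : measurableType d) (V : measurableType d')
    (phi : T -> V) A :
  measurable_fun setT phi -> measurable A -> measurable (phi @^-1` A).
Proof. by move=> mphi mA; rewrite -[X in measurable X]setTI; exact: mphi. Qed.

Lemma integral_setCl d (T : measurableType d) (R : realType)
    (m : {measure set T -> \bar R}) (f : T -> \bar R) A :
  measurable A -> m.-integrable setT f ->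
  (\int[m]_(x in ~` A) f x = \int[m]_x f x - \int[m]_(x in A) f x)%E.
Proof.
move=> mA intf; have mCA := measurableC mA.
have finA : (\int[m]_(x in A) f x \is a fin_num)%E.
  by apply: integrable_fin_num => //; exact: integrableS intf.
rewrite -(setUv A) integral_setU //=.
- by rewrite addeAC subee// add0e.
- by rewrite setUv; exact: measurable_int intf.
- by apply/disj_setPS; rewrite setICr.
Qed.

Section integral_transfer.
Local Open Scope ereal_scope.
Context d1 d2 d (T1 : measurableType d1) (T2 : measurableType d2)
  (V : measurableType d) (R : realType)
  (m1 : {measure set T1 -> \bar R}) (m2 : {measure set T2 -> \bar R})
  (phi1 : T1 -> V) (phi2 : T2 -> V).
Hypotheses (mphi1 : measurable_fun setT phi1) (mphi2 : measurable_fun setT phi2).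

(** The sets on which the two integrals agree form a Dynkin class: complements are handled by
    subtraction from the total, disjoint unions by countable additivity. Both use integrability,
    since [f1] and [f2] may change sign. The totals are compared in a separate hypothesis because
    [G] need not contain the whole space. *)
Lemma eq_integral_preimage (f1 : T1 -> \bar R) (f2 : T2 -> \bar R)
    (G : set (set V)) :
  measurable = <<s G >> -> setI_closed G ->
  m1.-integrable setT f1 -> m2.-integrable setT f2 ->
  \int[m1]_x f1 x = \int[m2]_x f2 x ->
  (forall A, G A ->
    \int[m1]_(x in phi1 @^-1` A) f1 x = \int[m2]_(x in phi2 @^-1` A) f2 x) ->
  forall A, measurable A ->
    \int[m1]_(x in phi1 @^-1` A) f1 x = \int[m2]_(x in phi2 @^-1` A) f2 x.
Proof.
move=> mG GI int1 int2 f12 fG A mA; rewrite mG in mA.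
move: A mA; apply: dynkin_induction => //.
- by move=> S mS fS; rewrite -!preimage_setC !integral_setCl ?fS ?f12//;
    exact: measurable_preimage.
- move=> F mF tF fF.
  have intp d' (T : measurableType d') (m : {measure set T -> \bar R})
      (phi : T -> V) f : measurable_fun setT phi -> m.-integrable setT f ->
      \int[m]_(x in phi @^-1` (\bigcup_k F k)) f x =
      \sum_(k <oo) \int[m]_(x in phi @^-1` F k) f x.
    move=> mphi intf; rewrite preimage_bigcup integral_bigcup//.
    + by move=> i j _ _ [x [Fi Fj]]; apply: tF => //; exists (phi x).
    + by move=> k; exact: measurable_preimage.
    + apply: integrableS intf => //.
      by apply: bigcup_measurable => k _; exact: measurable_preimage.
  by rewrite !intp//; apply: eq_eseriesr => k _; exact: fF.
Qed.

Section density.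
Context (f1 : T1 -> R) (f2 : T2 -> R).
Hypotheses (mf1 : measurable_fun setT f1) (mf2 : measurable_fun setT f2).
Hypotheses (f10 : forall x, (0 <= f1 x)%R) (f20 : forall x, (0 <= f2 x)%R).
Hypothesis f12 : forall A, measurable A ->
  \int[m1]_(x in phi1 @^-1` A) (f1 x)%:E = \int[m2]_(x in phi2 @^-1` A) (f2 x)%:E.

(** The right-hand side sees [phi] and [f] only through integrals of [f] over preimages under [phi],
    which are exactly the quantities that [f12] compares. *)
Let nnsfun_density d' (T : measurableType d') (m : {measure set T -> \bar R})
    (phi : T -> V) (f : T -> R) (h : {nnsfun V >-> R}) :
  measurable_fun setT phi -> measurable_fun setT f ->
  (forall x, (0 <= f x)%R) ->
  \int[m]_x (h (phi x) * f x)%:E = \sum_(y \in range h)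
    y%:E * \int[m]_(x in phi @^-1` (h @^-1` [set y])) (f x)%:E.
Proof.
move=> mphi mf f0.
have mhy (y : R) : measurable (phi @^-1` (h @^-1` [set y])).
  by apply: measurable_preimage => //; exact: measurable_sfunP.
transitivity (\int[m]_x \sum_(y \in range h)
    (y * \1_(h @^-1` [set y]) (phi x))%:E * (f x)%:E).
  apply: eq_integral => x _.
  rewrite -ge0_mule_fsuml; last by move=> y; rewrite (@nnfun_muleindic_ge0 _ _ _ h y (phi x)).
  by rewrite fsumEFin// -(fimfunE _ (phi x)) EFinM.
have mfE : measurable_fun setT (EFin \o f) by exact/measurable_EFinP.
have mindic (y : R) : measurable_fun setT (fun x => \1_(h @^-1` [set y]) (phi x) : R).
  have mI : measurable_fun setT (\1_(h @^-1` [set y]) : V -> R) by [].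
  exact: (measurableT_comp mI mphi).
pose g (y : R) (x : T) : R := (y * \1_(h @^-1` [set y]) (phi x))%R.
have mg y : measurable_fun setT (g y).
  apply: measurable_funM; last exact: mindic.
  exact: measurable_cst.
have mind (y : R) : measurable_fun setT (EFin \o g y) by exact/measurable_EFinP.
rewrite ge0_integral_fsum//; last 2 first.
- by move=> y; exact: (emeasurable_funM (mind y) mfE).
- move=> y x _; apply: mule_ge0; last by rewrite lee_fin.
  exact: (nnfun_muleindic_ge0 h y (phi x)).
apply: eq_fsbigr => y yh.
have y0 : (0 <= y)%R by move: yh; rewrite inE => -[x _ <-].
under eq_integral do rewrite EFinM -muleA.
rewrite ge0_integralZl//; last 2 first.
- by apply: (emeasurable_funM _ mfE); apply/measurable_EFinP; exact: mindic.
- by move=> x _; rewrite mule_ge0// lee_fin.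
congr (_ * _); rewrite [RHS]integral_mkcond; apply: eq_integral => x _.
rewrite patchE /= /indic; case: ifPn => [|]; rewrite ?inE ?notin_setE /= => hx.
  by rewrite mem_set// mul1e.
by rewrite memNset// mul0e.
Qed.

Let integral_density_lim d' (T : measurableType d')
    (m : {measure set T -> \bar R}) (phi : T -> V) (f : T -> R) (u : V -> \bar R)
    (mu : measurable_fun setT u) :
  measurable_fun setT phi -> measurable_fun setT f ->
  (forall x, (0 <= f x)%R) -> (forall y, 0 <= u y) ->
  \int[m]_x (u (phi x) * (f x)%:E) =
  limn (fun n => \int[m]_x (nnsfun_approx measurableT mu n (phi x) * f x)%:E).
Proof.
move=> mphi mf f0 u0; rewrite -monotone_convergence//.
- apply: eq_integral => x _; apply/esym/cvg_lim => //.
  under eq_fun do rewrite EFinM.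
  apply: cvgeZr => //.
  exact: cvg_nnsfun_approx.
- move=> n; apply/measurable_EFinP; apply: measurable_funM => //.
  exact: measurableT_comp.
- by move=> n x _; rewrite lee_fin mulr_ge0.
- move=> x _ a b ab; rewrite lee_fin ler_wpM2r//.
  exact/lefP/nd_nnsfun_approx.
Qed.

(** By [f12], the measures with densities [f1] and [f2] have the same image on [V]. The identity
    holds for simple functions and passes to increasing limits. *)
Lemma ge0_integral_density_transfer (u : V -> \bar R) :
  measurable_fun setT u -> (forall y, 0 <= u y) ->
  \int[m1]_x (u (phi1 x) * (f1 x)%:E) = \int[m2]_x (u (phi2 x) * (f2 x)%:E).
Proof.
move=> mu u0; rewrite (integral_density_lim m1 mu)// (integral_density_lim m2 mu)//.
congr (limn _).
apply/funext => n; rewrite !nnsfun_density//; apply: eq_fsbigr => y _.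
by rewrite f12//; exact: measurable_sfunP.
Qed.

Lemma integrable_density_transfer (u : V -> R) :
  measurable_fun setT u ->
  m1.-integrable setT (fun x => (u (phi1 x) * f1 x)%:E) ->
  m2.-integrable setT (fun x => (u (phi2 x) * f2 x)%:E).
Proof.
move=> mu /integrableP[_ int1]; apply/integrableP; split.
  by apply/measurable_EFinP; apply: measurable_funM => //; exact: measurableT_comp.
have mu' : measurable_fun setT (EFin \o (fun y => `|u y|%R)).
  by apply/measurable_EFinP; exact: measurableT_comp.
have absE d' (T : measurableType d') (m : {measure set T -> \bar R})
    (phi : T -> V) (f : T -> R) : (forall x, (0 <= f x)%R) ->
    \int[m]_x `|(u (phi x) * f x)%:E| = \int[m]_x (`|u (phi x)|%:E * (f x)%:E).
  by move=> f0; apply: eq_integral => x _; rewrite /= normrM (ger0_norm (f0 _)) EFinM.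
rewrite absE// in int1; rewrite absE//.
by rewrite -(ge0_integral_density_transfer mu')// => y; rewrite lee_fin.
Qed.

(** A nonnegative weight factors out of the positive and negative parts, which transfer separately,
    infinite values included. *)
Lemma integral_density_transfer (u : V -> R) :
  measurable_fun setT u ->
  \int[m1]_x (u (phi1 x) * f1 x)%:E = \int[m2]_x (u (phi2 x) * f2 x)%:E.
Proof.
move=> mu; rewrite integralE [RHS]integralE.
have posE d' (T : measurableType d') (phi : T -> V) (f : T -> R) :
    (forall x, (0 <= f x)%R) ->
    (fun x => (u (phi x) * f x)%:E)^\+ =
    (fun x => (EFin \o u)^\+ (phi x) * (f x)%:E).
  by move=> f0; apply/funext => x;
    rewrite !funeposE/= maxe_pMl ?mul0e// lee_fin.
have negE d' (T : measurableType d') (phi : T -> V) (f : T -> R) :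
    (forall x, (0 <= f x)%R) ->
    (fun x => (u (phi x) * f x)%:E)^\- =
    (fun x => (EFin \o u)^\- (phi x) * (f x)%:E).
  by move=> f0; apply/funext => x;
    rewrite !funenegE/= maxe_pMl ?mul0e ?lee_fin// -EFinM mulNr.
have muE : measurable_fun setT (EFin \o u) by exact/measurable_EFinP.
rewrite !posE// !negE//.
rewrite (ge0_integral_density_transfer (measurable_funepos muE))//.
by rewrite (ge0_integral_density_transfer (measurable_funeneg muE)).
Qed.

End density.
End integral_transfer.

(** * Lower orthants, rectangles and the product of the marginals *)

Lemma setI_closed_lower_orthant (R : realType) n :
  setI_closed (range (@lower_orthant R n)).
Proof.
move=> _ _ [x _ <-] [y _ <-].
exists [tuple Num.min (tnth x i) (tnth y i) | i < n] => //.
apply/seteqP; split => t /=.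
- move=> txy; split => i; move: (txy i); rewrite tnth_mktuple le_min => /andP[];
  by [].
- by move=> [tx ty] i; rewrite tnth_mktuple le_min tx ty.
Qed.

Lemma measurable_rectangle d (T : measurableType d) n (B : 'I_n -> set T) :
  (forall i, measurable (B i)) ->
  measurable [set t : n.-tuple T | forall i, B i (tnth t i)].
Proof.
move=> mB; rewrite (_ : mkset _ =
    \bigcap_(i in [set: 'I_n]) (fun t => tnth t i) @^-1` (B i)).
  apply: fin_bigcap_measurable => // i _.
  by apply: measurable_preimage => //; exact: measurable_tnth.
by apply/seteqP; split => t /= tB i; [move=> _|]; exact: tB.
Qed.

Lemma lower_orthantE (R : realType) n (x : n.-tuple R) :
  lower_orthant x = [set t | forall i, `]-oo, (tnth x i)]%classic (tnth t i)].
Proof.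
by apply/seteqP; split => t /= tx i; have := tx i; rewrite /= in_itv.
Qed.

Lemma measurable_lower_orthant (R : realType) n (x : n.-tuple R) :
  measurable (lower_orthant x).
Proof.
rewrite lower_orthantE; apply: (@measurable_rectangle _ R n (fun i => `]-oo, tnth x i]%classic)).
by move=> i; exact: measurable_itv.
Qed.

(** It suffices that each coordinate is measurable for the sigma-algebra generated by the orthants.
    The half-space where coordinate [i] is at most [x] is the union over k of the orthants with
    bound [x] at [i] and bound k at every other coordinate. *)
Lemma measurable_lower_orthantE (R : realType) n :
  @measurable _ (n.-tuple R) = <<s range (@lower_orthant R n) >>.
Proof.
apply/seteqP; split; last first.
  apply: smallest_sub; first exact: sigma_algebra_measurable.
  by move=> _ [x _ <-]; exact: measurable_lower_orthant.
apply: smallest_sub; first exact: smallest_sigma_algebra.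
move=> A; rewrite -bigcup_seq => -[i _ [B mB <-]].
pose T := g_sigma_algebraType (range (@lower_orthant R n)).
suff : measurable_fun [set: T] (fun t : T => tnth (t : n.-tuple R) i).
  by move=> /(_ measurableT B mB).
apply: (measurability _ (RGenOInfty.measurableE R)) => // _ [_ [x ->] <-].
rewrite setTI -[X in measurable X]setCK; apply: measurableC.
rewrite (_ : ~` _ = \bigcup_k (lower_orthant
    [tuple if j == i then x else k%:R | j < n] : set T)).
  by apply: bigcupT_measurable => k; apply: sub_sigma_algebra; eexists.
apply/seteqP; split => t /=.
- rewrite in_itv/= andbT => /negP; rewrite -leNgt => tx.
  have [k tk] : exists k : nat, forall j, tnth (t : n.-tuple R) j <= k%:R.
    exists (\max_(j < n) (Num.truncn `|tnth (t : n.-tuple R) j|).+1)%N => j.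
    rewrite (le_trans (ler_norm _))// (le_trans (ltW (truncnS_gt _)))// ler_nat.
    exact: (leq_bigmax j).
  by exists k => // j; rewrite tnth_mktuple; case: eqP => [->|_].
- move=> [k _ /(_ i)]; rewrite tnth_mktuple eqxx => tx.
  by rewrite in_itv/= andbT; apply/negP; rewrite -leNgt.
Qed.

Lemma product_probability_rectangle (R : realType) n
    (mu : 'I_n -> probability R R) (B : 'I_n -> set R) :
  (forall i, measurable (B i)) ->
  product_probability mu [set t | forall i, B i (tnth t i)] =
  (\prod_(i < n) mu i (B i))%E.
Proof.
elim: n mu B => [|n IH] mu B mB.
  by rewrite big_ord0 /= diracE mem_set// => -[].
rewrite big_ord_recl -(IH _ (fun i => B (lift ord0 i)))//=.
rewrite /distribution /pushforward.
rewrite (_ : _ @^-1` _ =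
  B ord0 `*` [set t | forall i, B (lift ord0 i) (tnth t i)]).
  rewrite product_measure1E//.
  exact: (@measurable_rectangle _ R n (fun i => B (lift ord0 i))).
apply/seteqP; split => -[x t] /=.
- move=> xtB; split=> [|i]; first by have := xtB ord0.
  by have := xtB (lift ord0 i); rewrite /pair_cons tnthS.
- move=> [Bx Bt] i; have [->|] := eqVneq i ord0; first exact: Bx.
  by case: (unliftP ord0 i) => [j ->|->]; rewrite ?eqxx// tnthS.
Qed.

(** * Equality of laws, and the density formula beyond orthants *)

Lemma measurable_rv_tuple d (T : measurableType d) (R : realType)
    (P : probability T R) n (X : 'I_n -> {RV P >-> R}) :
  measurable_fun setT (rv_tuple X).
Proof.
apply/measurable_fun_tnthP => i.
rewrite (_ : _ \o _ = X i) //.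
by apply/funext => w; rewrite /= tnth_mktuple.
Qed.

HB.instance Definition _ d (T : measurableType d) (R : realType)
    (P : probability T R) n (X : 'I_n -> {RV P >-> R}) :=
  isMeasurableFun.Build _ _ _ _ (rv_tuple X) (measurable_rv_tuple X).

Lemma measurable_subtuple (R : realType) n c (s : c.-tuple 'I_n) :
  measurable_fun setT (@subtuple R n c s).
Proof.
apply/measurable_fun_tnthP => l.
rewrite (_ : _ \o _ = fun t => tnth t (tnth s l)); first exact: measurable_tnth.
by apply/funext => t; rewrite /= tnth_mktuple.
Qed.

Lemma probability_integral1 d (T : measurableType d) (R : realType)
    (P : probability T R) (A : set T) : measurable A ->
  (\int[P]_(w in A) (1 : R)%:E = P A)%E.
Proof. by move=> mA; rewrite integral_cst// mul1e. Qed.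

Lemma eq_probability_preimage d1 d2 d (T1 : measurableType d1)
    (T2 : measurableType d2) (V : measurableType d) (R : realType)
    (P1 : probability T1 R) (P2 : probability T2 R)
    (phi1 : T1 -> V) (phi2 : T2 -> V) (G : set (set V)) :
  measurable_fun setT phi1 -> measurable_fun setT phi2 ->
  measurable = <<s G >> -> setI_closed G ->
  (forall A, G A -> P1 (phi1 @^-1` A) = P2 (phi2 @^-1` A)) ->
  forall A, measurable A -> P1 (phi1 @^-1` A) = P2 (phi2 @^-1` A).
Proof.
move=> mphi1 mphi2 mG GI PG A mA.
have mpre d' (T : measurableType d') (phi : T -> V) B :
    measurable_fun setT phi -> measurable B -> measurable (phi @^-1` B).
  exact: measurable_preimage.
rewrite -probability_integral1; last exact: mpre.
rewrite -[RHS]probability_integral1; last exact: mpre.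
move: A mA; apply: (eq_integral_preimage mphi1 mphi2 mG GI).
- exact: finite_measure_integrable_cst.
- exact: finite_measure_integrable_cst.
- by rewrite !probability_integral1// !probability_setT.
- move=> A GA; have mA : measurable A by rewrite mG; exact: sub_sigma_algebra.
  by rewrite !probability_integral1 ?PG//; exact: mpre.
Qed.

Lemma measurable_RGenInftyCE (R : realType) :
  @measurable _ R = <<s range (fun x : R => `]-oo, x]%classic) >>.
Proof.
apply/seteqP; split; last first.
  apply: smallest_sub; first exact: sigma_algebra_measurable.
  by move=> _ [x _ <-]; exact: measurable_itv.
rewrite [X in X `<=` _](RGenOInfty.measurableE R).
apply: smallest_sub; first exact: smallest_sigma_algebra.
move=> _ [x ->]; rewrite -setCitvl.
pose T := g_sigma_algebraType (range (fun x : R => `]-oo, x]%classic)).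
suff: measurable (~` `]-oo, x]%classic : set T) by [].
by apply: measurableC; apply: sub_sigma_algebra; exists x.
Qed.

Lemma eq_cdf_distribution d1 d2 (T1 : measurableType d1)
    (T2 : measurableType d2) (R : realType)
    (P1 : probability T1 R) (P2 : probability T2 R)
    (X1 : {RV P1 >-> R}) (X2 : {RV P2 >-> R}) :
  cdf X1 =1 cdf X2 ->
  forall A, measurable A -> P1 (X1 @^-1` A) = P2 (X2 @^-1` A).
Proof.
move=> X12.
apply: (@eq_probability_preimage _ _ _ _ _ _ _ _ _ _ _
  (range (fun x : R => `]-oo, x]%classic))) => //.
- exact: measurable_RGenInftyCE.
- move=> _ _ [x _ <-] [y _ <-]; exists (Num.min x y) => //.
  by apply/seteqP; split => z /=; rewrite !in_itv/= le_min => /andP.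
- by move=> _ [x _ <-]; exact: X12.
Qed.

Section independent_copy.
Context d d' (T : measurableType d) (T' : measurableType d') (R : realType)
  (P : probability T R) (P' : probability T' R) (n : nat)
  (X : 'I_n -> {RV P >-> R}) (xi : 'I_n -> {RV P' >-> R}).
Hypothesis xi_indep : mutually_independent xi.
Hypothesis xi_cdf : forall k x, cdf (xi k) x = cdf (X k) x.

(** On an orthant both sides are the product of the marginal cdf's, and orthants determine a
    probability. *)
Lemma law_independent_copy A : measurable A ->
  P' (rv_tuple xi @^-1` A) = product_of_marginals X A.
Proof.
move: A; apply: (@eq_probability_preimage _ _ _ _ _ _ _ _ _ _ idfun
    (range (@lower_orthant R n))) => //.
- exact: measurable_id.
- exact: measurable_lower_orthantE.
- exact: setI_closed_lower_orthant.
move=> _ [x _ <-]; rewrite preimage_id lower_orthantE.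
rewrite [RHS](@product_probability_rectangle R n _ (fun i => `]-oo, tnth x i]%classic)); last first.
  by move=> i; exact: measurable_itv.
have := xi_indep [set: 'I_n]%SET (fun i => @measurable_itv R `]-oo, tnth x i]).
rewrite (_ : \bigcap_(i in _) _ =
   rv_tuple xi @^-1` [set t | forall i, `]-oo, tnth x i]%classic (tnth t i)]).
  move=> ->; apply: eq_big => [i|i _]; first by rewrite inE.
  exact: xi_cdf.
apply/seteqP; split => w /= xw i; rewrite ?tnth_mktuple.
  by apply: xw; rewrite /= inE.
by move=> _; have := xw i; rewrite tnth_mktuple.
Qed.

(** [has_density_wrt_marginals] speaks of orthants only. Extending it to Borel sets calls for
    integrability, as [h] may change sign, and for the total integral 1, as the whole space is not
    an orthant. *)
Lemma density_law (h : n.-tuple R -> R) :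
  measurable_fun setT h ->
  P'.-integrable setT (fun w => (h (rv_tuple xi w))%:E) ->
  (\int[P']_w (h (rv_tuple xi w))%:E = 1)%E ->
  has_density_wrt_marginals X h ->
  forall A, measurable A ->
    P (rv_tuple X @^-1` A) =
    (\int[P']_(w in rv_tuple xi @^-1` A) (h (rv_tuple xi w))%:E)%E.
Proof.
move=> mh inth h1 dens A mA.
have mX := measurable_rv_tuple X; have mxi := measurable_rv_tuple xi.
rewrite -probability_integral1; last exact: measurable_preimage.
move: A mA; apply: (eq_integral_preimage mX mxi
  (@measurable_lower_orthantE R n) (@setI_closed_lower_orthant R n)) => //.
- exact: finite_measure_integrable_cst.
- by rewrite probability_integral1// probability_setT h1.
move=> _ [x _ <-]; have mx := measurable_lower_orthant x.
rewrite probability_integral1; last exact: measurable_preimage.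
rewrite -/(joint_cdf X x) dens.
rewrite (eq_measure_integral (distribution P' (rv_tuple xi))); last first.
  by move=> A mA _; apply/esym/law_independent_copy.
rewrite integral_pushforward//.
- exact/measurable_EFinP.
- by apply: integrableS inth => //; exact: measurable_preimage.
Qed.

End independent_copy.

(** * Independence of complementary groups of coordinates, and centred functions *)

Section independence.
Context d (T : measurableType d) (R : realType) (P : probability T R) (n : nat)
  (xi : 'I_n -> {RV P >-> R}).
Hypothesis xi_indep : mutually_independent xi.

Definition rv_event (S : {set 'I_n}) (B : 'I_n -> set R) : set T :=
  \bigcap_(i in [set` S]) xi i @^-1` B i.

Lemma measurable_rv_event S B : (forall i, measurable (B i)) ->
  measurable (rv_event S B).
Proof.
move=> mB; apply: fin_bigcap_measurable => // i _.
exact: measurable_preimage.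
Qed.

(** Taking [B] on [S] and [C] off [S] yields a single family for mutual independence; its product
    over all indices then splits along [S]. *)
Lemma independent_rv_event S (B C : 'I_n -> set R) :
  (forall i, measurable (B i)) -> (forall i, measurable (C i)) ->
  P (rv_event S B `&` rv_event (~: S) C) =
  (P (rv_event S B) * P (rv_event (~: S) C))%E.
Proof.
move=> mB mC; pose D i := if i \in S then B i else C i.
have mD i : measurable (D i) by rewrite /D; case: ifP.
rewrite (_ : rv_event S B `&` _ = rv_event [set: 'I_n] D).
  rewrite [in LHS]/rv_event !xi_indep// (bigID (mem S))/=; congr (_ * _)%E.
    by apply: eq_big => [i|i /andP[_ iS]]; rewrite ?inE// /D iS.
  by apply: eq_big => [i|i /andP[_ /negbTE iS]]; rewrite ?inE// /D iS.
apply/seteqP; split => w /=.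
  move=> [wB wC] i _; rewrite /D /=; case: ifPn => iS; first exact: wB.
  by apply: wC; rewrite /= inE.
move=> wD; split => i /= iS.
  by have := wD i; rewrite /D/= iS; apply; rewrite inE.
have := wD i; rewrite /D/=; move: iS; rewrite inE => /negbTE ->; apply.
by rewrite inE.
Qed.

(* Zeroing the coordinates outside S keeps the ambient type n.-tuple R, so that
   independence can be tested on the orthants that generate its sigma-algebra. *)
Definition padded_tuple (S : {set 'I_n}) (w : T) : n.-tuple R :=
  [tuple if i \in S then xi i w else 0 | i < n].

Lemma measurable_padded_tuple S : measurable_fun setT (padded_tuple S).
Proof.
apply/measurable_fun_tnthP => i.
rewrite (_ : _ \o _ = if i \in S then (xi i : T -> R) else cst 0).
  by case: ifP.
by apply/funext => w; rewrite /= tnth_mktuple; case: ifP.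
Qed.

(** Independence cast as a transfer: the indicator of the event outside [S] and the constant equal
    to its probability have the same integral over every event determined by [padded_tuple S]. *)
Lemma integral_independent_event S (C : 'I_n -> set R) (f : n.-tuple R -> R) :
  (forall i, measurable (C i)) -> measurable_fun setT f ->
  (\int[P]_(w in rv_event (~: S) C) (f (padded_tuple S w))%:E =
   \int[P]_w (f (padded_tuple S w) * fine (P (rv_event (~: S) C)))%:E)%E.
Proof.
move=> mC mf; set D := rv_event _ _.
have mD : measurable D by exact: measurable_rv_event.
have PD : P D \is a fin_num by exact: fin_num_measure.
have mpad := measurable_padded_tuple S.
transitivity (\int[P]_w (f (padded_tuple S w) * \1_D w)%:E)%E.
  rewrite integral_mkcond; apply: eq_integral => w _.
  by rewrite patchE indicE; case: (w \in D); rewrite ?mulr1 ?mulr0.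
apply: (@integral_density_transfer _ _ _ _ _ _ _ P P (padded_tuple S) (padded_tuple S)) => //.
- by move=> w; rewrite fine_ge0.
apply: (eq_integral_preimage mpad mpad (@measurable_lower_orthantE R n)
  (@setI_closed_lower_orthant R n)).
- exact: integrable_indic.
- exact: finite_measure_integrable_cst.
- rewrite integral_indic// setIT integral_cst// fineK// -[LHS]mule1.
  by congr (_ * _)%E; exact/esym/probability_setT.
move=> _ [x _ <-].
have mpx : measurable (padded_tuple S @^-1` lower_orthant x).
  by apply: measurable_preimage => //; exact: measurable_lower_orthant.
rewrite integral_indic// integral_cst// fineK// setIC.
(* Outside [S] the padded coordinates are 0: a negative bound there makes the preimage empty, and a
   nonnegative one imposes no condition. *)
have [[i [iS xi0]]|x0] := pselect (exists i, i \notin S /\ ~ (0 <= tnth x i)).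
  rewrite (_ : padded_tuple S @^-1` _ = set0) ?set0I ?measure0 ?mule0//.
  apply/seteqP; split => // w /= /(_ i).
  by rewrite tnth_mktuple (negbTE iS).
rewrite (_ : padded_tuple S @^-1` _ = rv_event S (fun i => `]-oo, tnth x i]%classic)).
  by rewrite muleC; apply: independent_rv_event => // i; exact: measurable_itv.
apply/seteqP; split => w /= xw i.
  by move=> /= iS; have := xw i; rewrite tnth_mktuple iS in_itv.
rewrite tnth_mktuple; case: ifPn => iS.
  by have := xw i iS; rewrite /= in_itv.
by apply: contrapT => h; apply: x0; exists i.
Qed.

Lemma sigma_rv_event (I : set 'I_n) (S : {set 'I_n}) (B : 'I_n -> set R) :
  (forall i, measurable (B i)) -> [set` S] `<=` I ->
  sigma_rv xi I (rv_event S B).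
Proof.
move=> mB SI; rewrite /sigma_rv; set G := \bigcup_(_ in _) _.
suff: measurable (rv_event S B : set (g_sigma_algebraType G)) by [].
apply: fin_bigcap_measurable => // i Si; apply: sub_sigma_algebra.
by exists i; [exact: SI|exists (B i); rewrite ?setTI].
Qed.

(* A canonical function is centred given all but one of its own arguments; the
   arguments outside s are split off by independence. *)
Lemma integral_canonical_eq0 c (s : c.-tuple 'I_n) (f : c.-tuple R -> R)
    (k : 'I_c) (B : 'I_n -> set R) :
  uniq s -> measurable_fun setT f ->
  P.-integrable setT (fun w => (f (subtuple s (rv_tuple xi w)))%:E) ->
  is_cond_expectation P (sigma_rv xi [set tnth s l | l in [set l | l != k]])
    (fun w => f (subtuple s (rv_tuple xi w))) (cst 0) ->
  (forall i, measurable (B i)) -> B (tnth s k) = setT ->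
  (\int[P]_(w in rv_event [set: 'I_n] B) (f (subtuple s (rv_tuple xi w)))%:E
   = 0)%E.
Proof.
move=> us mf intf [_ _ condE] mB BT.
pose S := [set i in s]%SET.
(* Position [k] is left out so that [D] belongs to the conditioning sigma-algebra; nothing is lost,
   because [B (tnth s k)] is everything. *)
pose D := rv_event (S :\ tnth s k) B.
(* [E] is [D] seen on padded tuples, so that the indicator of [D] can be absorbed into the function
   given to [integral_independent_event]. *)
pose E : set (n.-tuple R) :=
  [set t | forall i, (if i \in S then B i else setT) (tnth t i)].
have mE : measurable E.
  apply: (@measurable_rectangle _ R n (fun i => if i \in S then B i else setT)).
  by move=> i; case: ifP.
have mD : measurable D by exact: measurable_rv_event.
have DE w : (padded_tuple S w \in E) = (w \in D).
  apply/idP/idP; rewrite !inE /E /D /rv_event/= => wE i.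
    by rewrite /= !inE => /andP[_ iS]; have := wE i; rewrite tnth_mktuple inE iS.
  rewrite inE tnth_mktuple inE; case: ifPn => // iS.
  have [->|ik] := eqVneq i (tnth s k); first by rewrite BT.
  by apply: wE; rewrite /= !inE ik.
have subE w : subtuple s (padded_tuple S w) = subtuple s (rv_tuple xi w).
  by apply: eq_from_tnth => l; rewrite !tnth_mktuple inE mem_tnth.
have msub := @measurable_subtuple R n c s.
have D0 : (\int[P]_(w in D) (f (subtuple s (rv_tuple xi w)))%:E = 0)%E.
  rewrite -condE; first exact: integral0_eq.
  apply: sigma_rv_event => // i /=; rewrite !inE => /andP[ik /tnthP[l il]].
  by exists l => //=; apply: contra_neq ik => <-.
have mh : measurable_fun setT (fun t => f (subtuple s t) * \1_E t).
  apply: measurable_funM; first exact: measurableT_comp.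
  exact: measurable_indic.
have := integral_independent_event S mB mh.
under eq_integral do rewrite subE indicE DE.
under [in RHS]eq_integral do rewrite subE indicE DE.
set p := fine _.
have -> : (\int[P]_w (f (subtuple s (rv_tuple xi w)) * (w \in D)%:R * p)%:E = 0)%E.
  under eq_integral do rewrite EFinM.
  rewrite integralZr//; last first.
    rewrite (_ : (fun _ => _) = (fun w => (f (subtuple s (rv_tuple xi w)))%:E) \_ D).
      by apply/(integrable_mkcond _ mD); exact: integrableS intf.
    by apply/funext => w; rewrite patchE; case: (w \in D); rewrite ?mulr1 ?mulr0.
  rewrite (_ : \int[P]_x _ = 0)%E ?mul0e//.
  rewrite -D0 [RHS]integral_mkcond; apply: eq_integral => w _.
  by rewrite patchE; case: (w \in D); rewrite ?mulr1 ?mulr0.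
move=> <-; rewrite [LHS]integral_mkcond [RHS]integral_mkcond.
apply: eq_integral => w _; rewrite !patchE.
have -> : (w \in rv_event [set: 'I_n] B) =
    (w \in rv_event (~: S) B) && (w \in D).
  apply/idP/andP => [/set_mem wB|[/set_mem wSC /set_mem wD]].
    by split; apply/mem_set => i _; apply: wB; rewrite /= inE.
  apply/mem_set => i _; have [iS|iS] := boolP (i \in S); last first.
    by apply: wSC; rewrite /= inE.
  have [->|ik] := eqVneq i (tnth s k); first by rewrite /= BT.
  by apply: wD; rewrite /= !inE ik; move: iS; rewrite inE.
by case: (w \in D); case: (w \in rv_event _ B); rewrite ?mulr1 ?mulr0.
Qed.

End independence.

(** * Isolating the index (i, j) in the canonical sum *)

(** Being duplicate-free and of length at least 2, [s] has both [i] and [j] as entries; strictly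
    sorted sequences with the same entries coincide. *)
Lemma increasing_sub_pair n c (s : c.-tuple 'I_n) (i j : 'I_n) :
  (i < j)%N -> (2 <= c)%N -> increasing_idx s ->
  (forall k, tnth s k \in [:: i; j]) -> tval s = [:: i; j].
Proof.
move=> ij c2 incs sij.
have irr : irreflexive (fun a b : 'I_n => (a < b)%N) by move=> a; rewrite ltnn.
have tr : transitive (fun a b : 'I_n => (a < b)%N).
  by move=> a b e; exact: ltn_trans.
have us : uniq s by exact: sorted_uniq incs.
have uij : uniq [:: i; j] by rewrite /= inE andbT neq_ltn ij.
have sub : {subset tval s <= [:: i; j]} by move=> x /tnthP[k ->].
apply: (irr_sorted_eq tr irr) => //; first by rewrite /= ij.
have sz : (size [:: i; j] <= size s)%N by rewrite size_tuple.
by have [] := uniq_min_size us sub sz.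
Qed.

Lemma increasing_pair n (i j : 'I_n) :
  (i < j)%N -> increasing_idx [tuple i; j].
Proof. by move=> ij; rewrite /increasing_idx /= ij. Qed.

(* The index s = (i, j) is excluded through tval, the length c of s being
   variable. *)
Definition remainder_sum (R : realType) n (i j : 'I_n)
    (g : indexed_functions R n) (t : n.-tuple R) : R :=
  \sum_(2 <= c < n.+1)
    \sum_(s : c.-tuple 'I_n | increasing_idx s && (tval s != [:: i; j]))
      g c s (subtuple s t).

Lemma canonical_sum_split (R : realType) n (i j : 'I_n)
    (g : indexed_functions R n) (t : n.-tuple R) :
  (2 <= n)%N -> (i < j)%N ->
  canonical_sum g t =
  g 2%N [tuple i; j] [tuple tnth t i; tnth t j] + remainder_sum i j g t.
Proof.
move=> n2 ij; rewrite /canonical_sum.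
under eq_bigr => c _ do
  rewrite (bigID (fun s : c.-tuple 'I_n => tval s == [:: i; j]))/=.
rewrite big_split/=; congr (_ + _).
(* An index equal to (i, j) has length 2, so only c = 2 contributes. *)
rewrite big_ltn// [X in _ + X]big_nat_cond [X in _ + X]big1 ?addr0; last first.
  move=> c /andP[/andP[c3 _] _]; apply: big_pred0 => s.
  apply/negbTE/negP => /andP[_ /eqP sij].
  by move: c3; rewrite -(size_tuple s) sij.
rewrite (big_pred1 [tuple i; j]) => [|s /=].
  congr (g _ _ _); apply: eq_from_tnth => k; rewrite tnth_mktuple.
  by case: k => -[|[|//]] k2; rewrite [RHS](tnth_nth (tnth t i)) (tnth_nth i).
rewrite -val_eqE /=; case: eqP => [sij|]; rewrite ?andbF// andbT.
by rewrite /increasing_idx sij /= ij.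
Qed.

(** * The joint law of a pair of coordinates *)

Section canonical.
Context d d' (T : measurableType d) (T' : measurableType d') (R : realType)
  (P : probability T R) (P' : probability T' R) (n : nat)
  (X : 'I_n -> {RV P >-> R}) (xi : 'I_n -> {RV P' >-> R})
  (g : indexed_functions R n).
Hypothesis n2 : (2 <= n)%N.
Hypothesis xi_indep : mutually_independent xi.
Hypothesis xi_cdf : forall k x, cdf (xi k) x = cdf (X k) x.
Hypothesis can_g : canonical_functions X xi g.

(** Integrability is bundled with the vanishing integral so that the property is stable under finite
    sums. It is required on the whole space, hence does not depend on [E]. *)
Let null_on (E : set T') (Y : T' -> R) :=
  P'.-integrable setT (EFin \o Y) /\ (\int[P']_(w in E) (Y w)%:E = 0)%E.

Let null_on0 E : null_on E (fun=> 0).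
Proof.
split; last exact: integral0_eq.
by rewrite (_ : _ \o _ = cst 0%E)//; exact: integrable0.
Qed.

Let null_onD E Y Z : measurable E ->
  null_on E Y -> null_on E Z -> null_on E (fun w => Y w + Z w).
Proof.
move=> mE [intY Y0] [intZ Z0]; split.
  rewrite (_ : _ \o _ = (EFin \o Y) \+ (EFin \o Z))%E//.
  exact: integrableD.
under eq_integral do rewrite EFinD.
by rewrite integralD ?Y0 ?Z0 ?adde0//; apply: integrableS (measurableT) _ _ _.
Qed.

Let null_on_sum (I : Type) (r : seq I) (Q : pred I) E (Y : I -> T' -> R) :
  measurable E -> (forall a, Q a -> null_on E (Y a)) ->
  null_on E (fun w => \sum_(a <- r | Q a) Y a w).
Proof.
move=> mE Y0; elim: r => [|a r IH].
  rewrite (_ : (fun _ => _) = fun=> 0); first exact: null_on0.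
  by apply/funext => w; rewrite big_nil.
rewrite (_ : (fun _ => _) = fun w =>
    (if Q a then Y a w else 0) + \sum_(b <- r | Q b) Y b w); last first.
  by apply/funext => w; rewrite big_cons; case: (Q a); rewrite ?add0r.
apply: null_onD => //; have := Y0 a; case: (Q a) => [|_]; first exact.
exact: null_on0.
Qed.

Let null_on_sum_nat a b E (Y : nat -> T' -> R) :
  measurable E -> (forall c, (a <= c)%N -> null_on E (Y c)) ->
  null_on E (fun w => \sum_(a <= c < b) Y c w).
Proof.
move=> mE Y0; rewrite (_ : (fun _ => _) = fun w =>
    \sum_(c <- index_iota a b | (a <= c < b)%N && true) Y c w); last first.
  by apply/funext => w; rewrite big_nat_cond.
by apply: null_on_sum => // c /andP[/andP[ac _] _]; exact: Y0.
Qed.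

Let rv_event_setT : rv_event xi [set: 'I_n] (fun=> setT) = setT.
Proof. by apply/seteqP; split. Qed.

Lemma canonical_null c (s : c.-tuple 'I_n) (k : 'I_c) (B : 'I_n -> set R) :
  (2 <= c)%N -> increasing_idx s -> (forall i, measurable (B i)) ->
  B (tnth s k) = setT ->
  (\int[P']_(w in rv_event xi [set: 'I_n] B)
    (g s (subtuple s (rv_tuple xi w)))%:E = 0)%E.
Proof.
move=> c2 incs mB BT; apply: (integral_canonical_eq0 xi_indep (k := k)) => //.
- apply: sorted_uniq incs => [a b e|a]; [exact: ltn_trans|exact: ltnn].
- exact: canonical_borel can_g _ _ _ _.
- exact: canonical_A1 can_g _ _ _ _.
- exact: canonical_A2 can_g _ _ _ _ _.
Qed.

(** The whole space is the event without constraints, so [canonical_null] applies at any position,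
    here the first. It follows that 1 + U_n has total integral 1, as [density_law] demands. *)
Lemma canonical_sum_null :
  P'.-integrable setT (fun w => (canonical_sum g (rv_tuple xi w))%:E) /\
  (\int[P']_w (canonical_sum g (rv_tuple xi w))%:E = 0)%E.
Proof.
apply: null_on_sum_nat => // c c2; apply: null_on_sum => // s incs; split.
  exact: (canonical_A1 can_g).
rewrite -rv_event_setT.
exact: (@canonical_null c s (Ordinal (ltnW c2))).
Qed.

Lemma remainder_sum_null (i j : 'I_n) (A B : set R) :
  (i < j)%N -> measurable A -> measurable B ->
  P'.-integrable setT (fun w => (remainder_sum i j g (rv_tuple xi w))%:E) /\
  (\int[P']_(w in xi i @^-1` A `&` xi j @^-1` B)
     (remainder_sum i j g (rv_tuple xi w))%:E = 0)%E.
Proof.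
move=> ij mA mB.
have ji : (j == i) = false by apply/negbTE; rewrite neq_ltn ij orbT.
pose C l := if l == i then A else if l == j then B else setT.
have mC l : measurable (C l) by rewrite /C; do 2 case: ifP => // _.
have -> : xi i @^-1` A `&` xi j @^-1` B = rv_event xi [set: 'I_n] C.
  apply/seteqP; split => w /=.
    move=> [wA wB] l _ /=; rewrite /C.
    by case: eqP => [->//|_]; case: eqP => [->|].
  move=> wC; have := wC i; have := wC j; rewrite /C/= !eqxx ji => wB wA.
  by split; [apply: wA|apply: wB]; rewrite inE.
apply: null_on_sum_nat => [|c c2]; first exact: measurable_rv_event.
apply: null_on_sum => [|s /andP[incs sij]]; first exact: measurable_rv_event.
split; first exact: (canonical_A1 can_g).
have [k sk] : exists k, tnth s k \notin [:: i; j].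
  apply/not_existsP => allk; move/eqP: sij; apply.
  apply: increasing_sub_pair => // k.
  by apply/negPn/negP; exact: allk.
apply: (@canonical_null c s k) => //; move: sk.
by rewrite !inE negb_or /C => /andP[/negbTE -> /negbTE ->].
Qed.

(** Canonical functions are known to be Borel at relevant indices only, so the terms outside [Q] are
    replaced by the constant 0. *)
Let measurable_sum_cond (I : Type) (r : seq I) (Q : pred I)
    (h : I -> n.-tuple R -> R) :
  (forall a, Q a -> measurable_fun setT (h a)) ->
  measurable_fun setT (fun t => \sum_(a <- r | Q a) h a t).
Proof.
move=> mh; rewrite (_ : (fun _ => _) = fun t =>
    \sum_(a <- r) (if Q a then h a else cst 0) t); last first.
  by apply/funext => t; rewrite big_mkcond; apply: eq_bigr => a _; case: ifP.
by apply: measurable_sum => a; case: ifP => // /mh.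
Qed.

Lemma measurable_canonical_sum : measurable_fun setT (canonical_sum g).
Proof.
rewrite (_ : canonical_sum g = fun t =>
  \sum_(c <- index_iota 2 n.+1 | (2 <= c < n.+1)%N && true)
    \sum_(s : c.-tuple 'I_n | increasing_idx s) g s (subtuple s t)).
  apply: measurable_sum_cond => c /andP[/andP[c2 _] _].
  apply: measurable_sum_cond => s incs.
  apply: measurableT_comp (measurable_subtuple s).
  exact: (canonical_borel can_g).
by apply/funext => t; rewrite /canonical_sum big_nat_cond.
Qed.

Lemma integrable_pair_function (i j : 'I_n) : (i < j)%N ->
  P'.-integrable setT
    (fun w => (g [tuple i; j] [tuple xi i w; xi j w])%:E).
Proof.
move=> ij; have := canonical_A1 can_g (leqnn 2) (increasing_pair ij).
congr (_.-integrable _ _); apply/funext => w; congr (g _ _)%:E.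
apply: eq_from_tnth => k; rewrite tnth_mktuple.
by case: k => -[|[|//]] k2; rewrite tnth_mktuple [RHS](tnth_nth 0) (tnth_nth i).
Qed.

Lemma pair_density (i j : 'I_n) (C : set (R * R)) : (i < j)%N -> measurable C ->
  P ((fun w => (X i w, X j w)) @^-1` C) =
  (\int[P']_(w in (fun w => (xi i w, xi j w)) @^-1` C)
     (1 + g [tuple i; j] [tuple xi i w; xi j w])%:E)%E.
Proof.
move=> ij mC.
have mXX : measurable_fun setT (fun w => (X i w, X j w)).
  exact: measurable_fun_pair.
have mxx : measurable_fun setT (fun w => (xi i w, xi j w)).
  exact: measurable_fun_pair.
have int1 : P'.-integrable setT (fun=> (1 : R)%:E).
  exact: finite_measure_integrable_cst.
have intg := integrable_pair_function ij.
have intk : P'.-integrable setT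
    (fun w => (1 + g [tuple i; j] [tuple xi i w; xi j w])%:E).
  by under eq_fun do rewrite EFinD; exact: integrableD.
have [ints s0] := canonical_sum_null.
(* Rectangles come first because the remainder is known to integrate to 0 only over product events.
   The pair event is read as a cylinder of n-tuples to apply [density_law]. *)
have rect A B : measurable A -> measurable B ->
    P (X i @^-1` A `&` X j @^-1` B) =
    (\int[P']_(w in xi i @^-1` A `&` xi j @^-1` B)
       (1 + g [tuple i; j] [tuple xi i w; xi j w])%:E)%E.
  move=> mA mB.
  pose E : set (n.-tuple R) := (fun t => tnth t i) @^-1` A `&` (fun t => tnth t j) @^-1` B.
  have mE : measurable E.
    by apply: measurableI; apply: measurable_preimage => //; exact: measurable_tnth.
  have preE d0 (T0 : measurableType d0) (P0 : probability T0 R)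
      (Y : 'I_n -> {RV P0 >-> R}) :
      Y i @^-1` A `&` Y j @^-1` B = rv_tuple Y @^-1` E.
    by apply/seteqP; split => w; rewrite /E /= !tnth_mktuple.
  have mxE : measurable (rv_tuple xi @^-1` E).
    by apply: measurable_preimage => //; exact: measurable_rv_tuple.
  have [intr r0] := remainder_sum_null ij mA mB.
  rewrite preE (density_law xi_indep xi_cdf _ _ _ (canonical_density can_g))//.
  - rewrite preE.
    under eq_integral do rewrite (canonical_sum_split _ _ n2 ij) addrA EFinD !tnth_mktuple.
    rewrite integralD//; last 2 first.
    + exact: integrableS intk.
    + exact: integrableS intr.
    by rewrite -preE r0 adde0.
  - exact: measurable_funD (measurable_cst _) measurable_canonical_sum.
  - by under eq_fun do rewrite EFinD; exact: integrableD.
  - under eq_integral do rewrite EFinD.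
    by rewrite integralD// s0 adde0 probability_integral1// probability_setT.
rewrite -probability_integral1; last exact: measurable_preimage.
move: C mC; apply: (eq_integral_preimage mXX mxx
  (@measurable_prod_measurableType _ _ R R)) => //.
- move=> _ _ [A1 mA1 [B1 mB1 <-]] [A2 mA2 [B2 mB2 <-]].
  exists (A1 `&` A2); first exact: measurableI.
  by exists (B1 `&` B2); [exact: measurableI|rewrite setXI].
- exact: finite_measure_integrable_cst.
- have := rect setT setT measurableT measurableT.
  rewrite !preimage_setT !setTI => <-.
  by rewrite probability_integral1.
- move=> _ [A mA [B mB <-]].
  rewrite probability_integral1; first exact: rect.
  by apply: measurable_preimage => //; exact: measurableX.
Qed.

End canonical.

(** * The expectation of a product of independent variables *)

Section product_expectation.
Context d (T : measurableType d) (R : realType) (P : probability T R)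
  (Y Z : {RV P >-> R}).
Hypothesis YZ : forall A B, measurable A -> measurable B ->
  P (Y @^-1` A `&` Z @^-1` B) = (P (Y @^-1` A) * P (Z @^-1` B))%E.

(** The weights are the indicator of the event that [Y] lies in [A] and the constant probability of
    that event; [YZ] says that they agree over the events determined by [Z]. *)
Let integral_independent (v : R -> R) (A : set R) :
  measurable_fun setT v -> (forall x, 0 <= v x) ->
  P.-integrable setT (fun w => (v (Z w))%:E) -> measurable A ->
  (\int[P]_(w in Y @^-1` A) (v (Z w))%:E =
   P (Y @^-1` A) * \int[P]_w (v (Z w))%:E)%E.
Proof.
move=> mv v0 intv mA.
have mYA : measurable (Y @^-1` A) by exact: measurable_preimage.
have PYA : P (Y @^-1` A) \is a fin_num by exact: fin_num_measure.
transitivity (\int[P]_w (v (Z w) * \1_(Y @^-1` A) w)%:E)%E.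
  rewrite integral_mkcond; apply: eq_integral => w _.
  by rewrite patchE indicE; case: (w \in _); rewrite ?mulr1 ?mulr0.
transitivity (\int[P]_w (v (Z w) * fine (P (Y @^-1` A)))%:E)%E.
  apply: (@integral_density_transfer _ _ _ _ _ _ _ P P Z Z) => //.
  - by move=> w; rewrite fine_ge0.
  - move=> B mB; have mZB : measurable (Z @^-1` B) by exact: measurable_preimage.
    by rewrite integral_indic// integral_cst// fineK//; exact: YZ.
under eq_integral do rewrite EFinM.
by rewrite integralZr// fineK// muleC.
Qed.

(** The roles are now exchanged: [v (Z w)] is the weight, and over events determined by [Y] it has
    the same integrals as the constant equal to its mean. The factor [Y] is then transferred with
    [u] the identity. *)
Lemma expectation_prod_ge0 (v : R -> R) :
  measurable_fun setT v -> (forall x, 0 <= v x) ->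
  P.-integrable setT (EFin \o Y) ->
  P.-integrable setT (fun w => (v (Z w))%:E) ->
  P.-integrable setT (fun w => (Y w * v (Z w))%:E) /\
  (\int[P]_w (Y w * v (Z w))%:E =
   \int[P]_w (Y w)%:E * \int[P]_w (v (Z w))%:E)%E.
Proof.
move=> mv v0 intY intv; set m := (\int[P]_w (v (Z w))%:E)%E.
have mE : m = (fine m)%:E by rewrite fineK//; exact: integrable_fin_num.
have m0 : 0 <= fine m.
  by apply: fine_ge0; apply: integral_ge0 => w _; rewrite lee_fin.
have mvZ : measurable_fun setT (fun w => v (Z w)) by exact: measurableT_comp.
have transY A : measurable A ->
    (\int[P]_(w in Y @^-1` A) (v (Z w))%:E =
     \int[P]_(w in Y @^-1` A) (fine m)%:E)%E.
  move=> mA; have mYA : measurable (Y @^-1` A) by exact: measurable_preimage.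
  by rewrite integral_independent// integral_cst// -/m -mE muleC.
split.
  apply: (@integrable_density_transfer _ _ _ _ _ _ _ P P Y Y _ _
    (cst (fine m)) (fun w => v (Z w)) _ _ _ _ _ idfun) => //.
  - by move=> A mA; rewrite transY.
  - exact: measurable_id.
  - by under eq_fun do rewrite EFinM; exact: integrableZr.
transitivity (\int[P]_w (Y w * fine m)%:E)%E.
  apply: (@integral_density_transfer _ _ _ _ _ _ _ P P Y Y _ _
    (fun w => v (Z w)) (cst (fine m)) _ _ _ _ _ idfun) => //.
  exact: measurable_id.
under eq_integral do rewrite EFinM.
by rewrite integralZr// mE.
Qed.

Lemma expectation_prod_eq0 :
  P.-integrable setT (EFin \o Y) -> P.-integrable setT (EFin \o Z) ->
  (\int[P]_w (Y w)%:E = 0)%E ->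
  P.-integrable setT (fun w => (Y w * Z w)%:E) /\
  (\int[P]_w (Y w * Z w)%:E = 0)%E.
Proof.
move=> intY intZ Y0.
(* Weights have to be nonnegative, hence the splitting of [Z] into its positive and negative
   parts. *)
pose vp (x : R) := Num.max x 0; pose vn (x : R) := Num.max (- x) 0.
have mvp : measurable_fun setT vp by exact: measurable_maxr.
have mvn : measurable_fun setT vn by exact: measurable_maxr.
have mZ : measurable_fun setT Z by [].
have intp : P.-integrable setT (fun w => (vp (Z w))%:E).
  apply: le_integrable intZ => //.
    by apply/measurable_EFinP; exact: measurableT_comp.
  move=> w _ /=; rewrite lee_fin /vp ger0_norm ?le_max ?lexx ?orbT//.
  by rewrite ge_max ler_norm normr_ge0.
have intn : P.-integrable setT (fun w => (vn (Z w))%:E).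
  apply: le_integrable intZ => //.
    by apply/measurable_EFinP; exact: measurableT_comp.
  move=> w _ /=; rewrite lee_fin /vn ger0_norm ?le_max ?lexx ?orbT//.
  by rewrite ge_max normr_ge0 -normrN ler_norm.
have vp0 x : 0 <= vp x by rewrite le_max lexx orbT.
have vn0 x : 0 <= vn x by rewrite le_max lexx orbT.
have [intYp Yp] := expectation_prod_ge0 mvp vp0 intY intp.
have [intYn Yn] := expectation_prod_ge0 mvn vn0 intY intn.
have E w : (Y w * Z w)%:E = ((Y w * vp (Z w))%:E - (Y w * vn (Z w))%:E)%E.
  rewrite -EFinB -mulrBr; congr (_ * _)%:E; rewrite /vp /vn.
  by case: (leP 0 (Z w)) => h; case: (leP 0 (- Z w)) => h2; lra.
split; first by under eq_fun do rewrite E; exact: integrableB.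
under eq_integral do rewrite E.
by rewrite integralB// Yp Yn Y0 !mul0e sube0.
Qed.

End product_expectation.

(** * Truncated densities and the product moment of a pair *)

(** The negative part of [K (phi w)] has as integral minus the integral of [K (phi w)] over the
    preimage of the set where [K] is negative; by hypothesis that is at most 0, so the negative part
    vanishes almost everywhere. The truncation supplies the pointwise nonnegativity that weights
    must have. *)
Lemma ae_eq_max0 d d' (T : measurableType d) (V : measurableType d')
    (R : realType) (P : probability T R) (phi : T -> V) (K : V -> R) :
  measurable_fun setT phi -> measurable_fun setT K ->
  P.-integrable setT (fun w => (K (phi w))%:E) ->
  (forall C, measurable C ->
    (0 <= \int[P]_(w in phi @^-1` C) (K (phi w))%:E)%E) ->
  ae_eq P setT (fun w => (Num.max (K (phi w)) 0)%:E) (fun w => (K (phi w))%:E).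
Proof.
move=> mphi mK intK K0.
have mKphi : measurable_fun setT (fun w => K (phi w)) by exact: measurableT_comp.
pose N := K @^-1` `]-oo, 0[%classic.
have mN : measurable N.
  by apply: measurable_preimage => //; exact: measurable_itv.
have mphiN : measurable (phi @^-1` N) by exact: measurable_preimage.
pose r w := Num.max (- K (phi w)) 0.
have r0 w : 0 <= r w by rewrite le_max lexx orbT.
have mr : measurable_fun setT r.
  exact: measurable_maxr (measurable_funN mKphi) (measurable_cst _).
have intr0 : (\int[P]_w (r w)%:E = 0)%E.
  apply/eqP; rewrite eq_le integral_ge0 ?andbT => [|w _]; last by rewrite lee_fin.
  rewrite (_ : \int[P]_w _ =
      \int[P]_(w in phi @^-1` N) (-1%:E * (K (phi w))%:E))%E.
    rewrite integralZl//; last exact: integrableS intK.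
    by rewrite EFinN mulN1e oppe_le0 K0.
  rewrite [RHS]integral_mkcond; apply: eq_integral => w _.
  rewrite patchE; case: ifPn => [/set_mem|/negP wN].
    rewrite /N /= in_itv/= => Kw; rewrite -EFinM mulN1r /r.
    by congr (_%:E); apply/max_idPl; rewrite oppr_ge0 ltW.
  rewrite /r; congr (_%:E); apply/max_idPr; rewrite oppr_le0 leNgt.
  by apply/negP => Kw; apply: wN; apply/mem_set; rewrite /N /= in_itv.
have : ae_eq P setT (EFin \o r) (cst 0%E).
  apply/ae_eq_integral_abs => //; first exact/measurable_EFinP.
  by rewrite -intr0; apply: eq_integral => w _; rewrite /= ger0_norm.
apply: filterS => w /(_ I)/= [] rw _; congr (_%:E).
by move: rw; rewrite /r; case: (leP 0 (K (phi w))) => // Kw;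
  case: (leP 0 (- K (phi w))) => Kw2; lra.
Qed.

Section pair_moment.
Context d d' (T : measurableType d) (T' : measurableType d') (R : realType)
  (P : probability T R) (P' : probability T' R) (n : nat)
  (X : 'I_n -> {RV P >-> R}) (xi : 'I_n -> {RV P' >-> R})
  (g : indexed_functions R n) (i j : 'I_n).
Hypothesis n2 : (2 <= n)%N.
Hypothesis xi_indep : mutually_independent xi.
Hypothesis xi_cdf : forall k x, cdf (xi k) x = cdf (X k) x.
Hypothesis can_g : canonical_functions X xi g.
Hypothesis ij : (i < j)%N.

Let gij w := g [tuple i; j] [tuple xi i w; xi j w].

(** The product of the two coordinates is transferred with weight 1 on the side of [X] and the
    truncated weight [k] on the side of [xi]; almost everywhere equality then restores 1 + g_ij,
    both for integrability and for the integral. *)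
Lemma pair_moment_transfer :
  (P.-integrable setT (fun w => (X i w * X j w)%:E) <->
   P'.-integrable setT (fun w => (xi i w * xi j w * (1 + gij w))%:E)) /\
  (\int[P]_w (X i w * X j w)%:E =
   \int[P']_w (xi i w * xi j w * (1 + gij w))%:E)%E.
Proof.
pose phi w := (xi i w, xi j w).
pose psi w := (X i w, X j w).
pose K (x : R * R) := 1 + g [tuple i; j] [tuple x.1; x.2].
pose k w := Num.max (K (phi w)) 0.
have mphi : measurable_fun setT phi by exact: measurable_fun_pair.
have mpsi : measurable_fun setT psi by exact: measurable_fun_pair.
have mK : measurable_fun setT K.
  apply: measurable_funD; first exact: measurable_cst.
  have mg := canonical_borel can_g (leqnn 2) (increasing_pair ij).
  apply: (measurableT_comp mg).
  apply/measurable_fun_tnthP => l; case: l => -[|[|//]] l2.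
  - by rewrite (_ : _ \o _ = fst)//; exact: measurable_fst.
  - by rewrite (_ : _ \o _ = snd)//; exact: measurable_snd.
have mKphi : measurable_fun setT (fun w => K (phi w)) by exact: measurableT_comp.
have mk : measurable_fun setT k.
  exact: measurable_maxr mKphi (measurable_cst _).
have intK : P'.-integrable setT (fun w => (K (phi w))%:E).
  under eq_fun do rewrite EFinD.
  apply: integrableD => //; first exact: finite_measure_integrable_cst.
  exact: (integrable_pair_function can_g ij).
have dens C : measurable C -> P (psi @^-1` C) =
    (\int[P']_(w in phi @^-1` C) (K (phi w))%:E)%E.
  exact: (pair_density n2 xi_indep xi_cdf can_g ij).
have aek : ae_eq P' setT (fun w => (k w)%:E) (fun w => (K (phi w))%:E).
  by apply: ae_eq_max0 => // C mC; rewrite -dens.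
have k0 w : 0 <= k w by rewrite le_max lexx orbT.
have f12 C : measurable C -> (\int[P]_(w in psi @^-1` C) (cst 1 w)%:E =
    \int[P']_(w in phi @^-1` C) (k w)%:E)%E.
  move=> mC; rewrite probability_integral1; last exact: measurable_preimage.
  have mphiC : measurable (phi @^-1` C) by exact: measurable_preimage.
  rewrite dens//; apply: ae_eq_integral => //.
  - exact/measurable_funTS/measurable_EFinP.
  - exact/measurable_funTS/measurable_EFinP.
  - by apply: filterS aek => w /(_ I) ->.
pose u (x : R * R) := x.1 * x.2.
have mu : measurable_fun setT u by exact: measurable_funM.
have muphi : measurable_fun setT (fun w => u (phi w)) by exact: measurableT_comp.
have XE : (fun w => (X i w * X j w)%:E) = (fun w => (u (psi w) * cst 1 w)%:E).
  by apply/funext => w; rewrite /= mulr1.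
have m1 : measurable_fun setT (fun w => (u (phi w) * k w)%:E).
  by apply/measurable_EFinP; exact: measurable_funM.
have m2 : measurable_fun setT (fun w => (u (phi w) * K (phi w))%:E).
  by apply/measurable_EFinP; exact: measurable_funM.
have aeu : ae_eq P' setT (fun w => (u (phi w) * k w)%:E)
    (fun w => (u (phi w) * K (phi w))%:E).
  by apply: filterS aek => w /(_ I) kw _; rewrite EFinM kw.
have intE : P'.-integrable setT (fun w => (u (phi w) * k w)%:E) <->
    P'.-integrable setT (fun w => (u (phi w) * K (phi w))%:E).
  have absE : (\int[P']_w `|(u (phi w) * k w)%:E| =
      \int[P']_w `|(u (phi w) * K (phi w))%:E|)%E.
    apply: ge0_ae_eq_integral => //; [exact: measurableT_comp..|].
    by apply: filterS aeu => w /(_ I) ->.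
  by split => /integrableP[_ h]; apply/integrableP; split => //; move: h; rewrite absE.
rewrite XE; split.
  apply: iff_trans intE; split; apply: integrable_density_transfer => //.
  by move=> C mC; rewrite f12.
rewrite -(ae_eq_integral _ _ measurableT m1 m2 aeu)//.
exact: integral_density_transfer.
Qed.

End pair_moment.

Theorem theorem5p4 (R : realType) (n : nat)
    (d : measure_display) (T : measurableType d) (P : probability T R)
    (X : 'I_n -> {RV P >-> R})
    (d' : measure_display) (T' : measurableType d') (P' : probability T' R)
    (xi : 'I_n -> {RV P' >-> R})
    (g : indexed_functions R n) :
  (2 <= n)%N ->
  (forall k, expectation_is P (X k) 0) ->
  joint_cdf_abs_continuous X ->
  mutually_independent xi ->
  (forall k x, cdf (xi k) x = cdf (X k) x) ->
  canonical_functions X xi g ->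
  orthogonal_rvs X <->
  (forall i j : 'I_n, (i < j)%N ->
     expectation_is P'
       (fun w => xi i w * xi j w * g 2%N [tuple i; j] [tuple xi i w; xi j w]) 0).
Proof.
move=> n2 X0 _ xi_indep xi_cdf can_g.
have xi0 k : P'.-integrable setT (EFin \o xi k) /\
    (\int[P']_w (xi k w)%:E = 0)%E.
  have [intX EX] := X0 k.
  (* Equality of the laws of [X k] and [xi k], in the shape of a transfer with both weights equal to
     1; integrability and mean 0 then pass to [xi k]. *)
  have law C : measurable C -> (\int[P]_(w in X k @^-1` C) (cst 1 w)%:E =
      \int[P']_(w in xi k @^-1` C) (cst 1 w)%:E)%E.
    move=> mC; rewrite !probability_integral1; [|exact: measurable_preimage..].
    by apply/esym/eq_cdf_distribution => //; exact: xi_cdf.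
  split.
    have := @integrable_density_transfer _ _ _ _ _ _ _ P P' (X k) (xi k)
      _ _ (cst 1) (cst 1) _ _ _ _ law idfun.
    rewrite (_ : (fun _ => _) = EFin \o X k); last first.
      by apply/funext => w; rewrite /= mulr1.
    rewrite (_ : (fun _ => _) = EFin \o xi k); last first.
      by apply/funext => w; rewrite /= mulr1.
    by apply => //; exact: measurable_id.
  rewrite expectation.unlock in EX; rewrite -[RHS]EX.
  have := @integral_density_transfer _ _ _ _ _ _ _ P P' (X k) (xi k)
    _ _ (cst 1) (cst 1) _ _ _ _ law idfun.
  under eq_integral do rewrite mulr1.
  under [in RHS]eq_integral do rewrite mulr1.
  by move=> <- //; exact: measurable_id.
have equiv (i j : 'I_n) : (i < j)%N ->
    expectation_is P (fun w => X i w * X j w) 0 <->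
    expectation_is P'
      (fun w => xi i w * xi j w * g 2%N [tuple i; j] [tuple xi i w; xi j w]) 0.
  move=> ij.
  have [intXX EXX] := pair_moment_transfer n2 xi_indep xi_cdf can_g ij.
  have pair_indep A B : measurable A -> measurable B ->
      P' (xi i @^-1` A `&` xi j @^-1` B) =
      (P' (xi i @^-1` A) * P' (xi j @^-1` B))%E.
    move=> mA mB; have ji : (j == i) = false.
      by apply/negbTE; rewrite neq_ltn ij orbT.
    have := xi_indep [set i; j]%SET (fun l => if l == i then A else B).
    rewrite big_setU1/=; last by rewrite inE eq_sym ji.
    rewrite big_set1 eqxx ji => <-; last by move=> l; case: ifP.
    congr (P' _); apply/seteqP; split => w /=.
      by move=> [wA wB] l /=; rewrite !inE => /orP[] /eqP ->; rewrite ?eqxx ?ji.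
    move=> h; split; [have := h i|have := h j]; rewrite /= !inE eqxx ?orbT ?ji;
      exact.
  have [intxx Exx] :=
    expectation_prod_eq0 pair_indep (xi0 i).1 (xi0 j).1 (xi0 i).2.
  pose f w := xi i w * xi j w * g 2%N [tuple i; j] [tuple xi i w; xi j w].
  pose q w := xi i w * xi j w.
  pose F w := q w * (1 + g 2%N [tuple i; j] [tuple xi i w; xi j w]).
  (* The sum and the difference serve the two directions: with [q] integrable, [f] and [F] are
     integrable together. *)
  have fD : EFin \o F = ((EFin \o q) \+ (EFin \o f))%E.
    by apply/funext => w; rewrite /= /F mulrDr mulr1 EFinD.
  have fB : EFin \o f = ((EFin \o F) \- (EFin \o q))%E.
    by apply/funext => w; rewrite /= /F mulrDr mulr1 -EFinB addrAC subrr add0r.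
  have intf : P.-integrable setT (fun w => (X i w * X j w)%:E) <->
      P'.-integrable setT (EFin \o f).
    apply: (iff_trans intXX); split => h; first by rewrite fB; exact: integrableB.
    by rewrite -/(EFin \o F) fD; exact: integrableD.
  have Ef : P'.-integrable setT (EFin \o f) ->
      (\int[P]_w (X i w * X j w)%:E = \int[P']_w (f w)%:E)%E.
    move=> h; rewrite EXX.
    under eq_integral do rewrite mulrDr mulr1 EFinD.
    by rewrite integralD// Exx add0e.
  rewrite /expectation_is !expectation.unlock; split => -[int E].
    have h := intf.1 int; split=> //; rewrite -E; exact/esym/Ef.
  by split; [exact/intf|rewrite -E; exact: Ef].
by split => h i j ij; apply/(equiv _ _ ij); exact: h.
Qed.
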